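(* Let $s\ge 9$ and $k\ge 8s$. Let $\mathcal{P}$ denote the set of all distributions $P$ of $Z=(X,A,Y)$, with $X\in\mathbb{R}^d$ and $A\in\{1,\dots,k\}$, for which: (i) $\frac{C'}{k}\le\pi_a(X)\le\frac{C''}{k}$ for all $a\in\{1,\dots,k\}$; (ii) $Y$ is binary, i.e. $Y\in\{0,1\}$; (iii) $(A,Y)$ is independent of $X$; (iv) the vector $\psi(P)=(\psi_1(P),\dots,\psi_k(P))$ with $\psi_a(P)=\int\mu_a(x)\,dP(x)$ is sparse in the sense that at most $s$ of its entries are different from $1/2$. Here $C',C''>0$ are constants for which $\mathcal{P}$ is nonempty (i.e. $C'\le 1\le C''$). Then $$\inf_{\widehat\psi}\sup_{P\in\mathcal{P}}\mathbb{E}_P\left\{\sum_{a=1}^k\varpi_a(P)\big(\widehat\psi_a-\psi_a(P)\big)^2\right\}\ \ge\ C\cdot\min\left(s\,\frac{\log(k/s)}{n},\ \frac{s}{k}\right),$$ where $\varpi_a(P)=P(A=a)$ and $C>0$ is a constant depending only on $C'$ and $C''$.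
   Context: $\mu_a(x)=\mathbb{E}_P(Y\mid X=x,A=a)$ and $\pi_a(x)=P(A=a\mid X=x)$. The infimum is over all estimators $\widehat\psi=(\widehat\psi_1,\dots,\widehat\psi_k)$, i.e. measurable $\mathbb{R}^k$-valued functions of an i.i.d. sample $Z_1,\dots,Z_n$ from $P$, and $\mathbb{E}_P$ is expectation over that sample. *)

(* Defs.v *)
From HB Require Import structures.
From mathcomp Require Import all_boot all_order all_algebra.
From mathcomp Require Import all_classical all_reals all_analysis.

Set Implicit Arguments.
Unset Strict Implicit.
Unset Printing Implicit Defensive.

Import Order.TTheory GRing.Theory Num.Theory.
Import numFieldNormedType.Exports.

Local Open Scope classical_set_scope.
Local Open Scope ring_scope.

(* MathComp-Analysis development. Measurable types are pointed, so the finite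
   label set of the treatment is 'I_k.+1: the number of treatment levels is
   k.+1, and the levels 1, ..., k.+1 are numbered 0, ..., k. *)
HB.instance Definition _ (k : nat) := isPointed.Build 'I_k.+1 ord0.
HB.instance Definition _ (k : nat) :=
  @isMeasurable.Build default_measure_display 'I_k.+1
    discrete_measurable discrete_measurable0
    discrete_measurableC discrete_measurableU.

Section iid_sample.
Context {dT : measure_display} {T : measurableType dT}.

Definition cons_tuple (n : nat) (z : T * n.-tuple T) : n.+1.-tuple T :=
  [tuple of z.1 :: z.2].

Lemma measurable_cons_tuple (n : nat) :
  measurable_fun [set: T * n.-tuple T] (@cons_tuple n).
Proof. exact: (measurable_cons measurable_fst measurable_snd). Qed.

HB.instance Definition _ (n : nat) :=
  isMeasurableFun.Build _ _ _ _ (@cons_tuple n) (@measurable_cons_tuple n).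

Context {R : realType}.

(* The n-fold product measure P^n, i.e. the law of n independent draws from P
   (see iid_box). *)
Fixpoint iid (P : probability T R) (n : nat) : probability (n.-tuple T) R :=
  if n is m.+1 then distribution (P \x iid P m)%E (@cons_tuple m)
  else dirac [tuple].

Lemma iid_box (P : probability T R) (n : nat) (B : 'I_n -> set T) :
  (forall i, measurable (B i)) ->
  (iid P n [set z | forall i, B i (tnth z i)] = \prod_(i < n) P (B i))%E.
Proof.
elim: n B => [|n IHn] B mB.
  by rewrite big_ord0 /= diracE mem_set// => i; case: i.
rewrite big_ord_recl /= /distribution /pushforward.
have -> : @cons_tuple n @^-1` [set z | forall i, B i (tnth z i)] =
    B ord0 `*` [set z | forall i, B (lift ord0 i) (tnth z i)].
  apply/seteqP; split => -[x z] /=.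
    move=> h; split; first by have := h ord0; rewrite tnth0.
    by move=> i; have := h (lift ord0 i); rewrite tnthS.
  move=> [h0 hS] i; case: (unliftP ord0 i) => [j|] ->.
    by rewrite tnthS; exact: hS.
  by rewrite tnth0.
rewrite product_measure1E//.
  by congr (_ * _)%E; exact: (IHn (fun i => B (lift ord0 i))).
have -> : [set z : n.-tuple T | forall i, B (lift ord0 i) (tnth z i)] =
    \bigcap_(i in [set: 'I_n]) ((fun z => tnth z i) @^-1` B (lift ord0 i)).
  by apply/seteqP; split => z /= h i; [move=> _|]; exact: h.
apply: fin_bigcap_measurable; first exact: finite_finset.
by move=> i _; rewrite -[X in measurable X]setTI; exact: measurable_tnth.
Qed.

End iid_sample.

Section conditional_expectation.
Context {dT dW : measure_display} {T : measurableType dT}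
  {W : measurableType dW} {R : realType}.

(* g is a version of w |-> E(V | U = w). *)
Definition is_cond_expectation (P : probability T R) (V : T -> R) (U : T -> W)
    (g : W -> R) : Prop :=
  [/\ measurable_fun [set: W] g,
      P.-integrable [set: T] (EFin \o (g \o U)) &
      forall B : set W, measurable B ->
        (\int[P]_(z in U @^-1` B) (g (U z))%:E =
         \int[P]_(z in U @^-1` B) (V z)%:E)%E].

(* A chosen version; it exists as soon as V is integrable, and any two versions
   agree almost everywhere for the law of U. *)
Definition cond_expectation (P : probability T R) (V : T -> R) (U : T -> W) :
    W -> R :=
  xget (cst 0) [set g | is_cond_expectation P V U g].

End conditional_expectation.

Definition independent_rv {dT dU dV : measure_display} {T : measurableType dT}
    {TU : measurableType dU} {TV : measurableType dV} {R : realType}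
    (P : probability T R) (U : T -> TU) (V : T -> TV) : Prop :=
  forall (B : set TU) (D : set TV), measurable B -> measurable D ->
    (P (U @^-1` B `&` V @^-1` D) = P (U @^-1` B) * P (V @^-1` D))%E.

(* Z = (X, A, Y); d.-tuple R carries the product, i.e. Borel, sigma-algebra. *)
Notation obs R d k := (d.-tuple R * 'I_k.+1 * R)%type.

Section model.
Context {R : realType} {d k : nat}.
Implicit Types (P : probability (obs R d k) R) (a : 'I_k.+1).

Definition covX (z : obs R d k) : d.-tuple R := z.1.1.
Definition trtA (z : obs R d k) : 'I_k.+1 := z.1.2.
Definition outY (z : obs R d k) : R := z.2.

Definition regression P a (x : d.-tuple R) : R :=
  cond_expectation P outY (fun z => (covX z, trtA z)) (x, a).

Definition propensity P a (x : d.-tuple R) : R :=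
  cond_expectation P (\1_[set z | trtA z = a]) covX x.

(* Integrating mu_a o X against P is integrating mu_a against the law of X;
   under positivity of the propensities the value does not depend on the chosen
   version of mu. *)
Definition psi P a : R := (\int[P]_z regression P a (covX z))%R.

Definition varpi P a : R := fine (P [set z | trtA z = a]).

Definition model (C1 C2 : R) (s : nat) : set (probability (obs R d k) R) :=
  [set P : probability (obs R d k) R |
    [/\ {ae P, forall z, forall a,
          C1 / k.+1%:R <= propensity P a (covX z) <= C2 / k.+1%:R},
        {ae P, forall z, outY z = 0 \/ outY z = 1},
        independent_rv P (fun z => (trtA z, outY z)) covX &
        (#|[set a | psi P a != 2^-1]%SET| <= s)%N]].

Definition risk (n : nat)
    (psihat : {mfun n.-tuple (obs R d k) >-> k.+1.-tuple R}) P : \bar R :=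
  (\int[iid P n]_z
     (\sum_a varpi P a * (tnth (psihat z) a - psi P a) ^+ 2)%:E)%E.

Definition minimax_risk (C1 C2 : R) (s n : nat) : \bar R :=
  ereal_inf [set ereal_sup [set risk psihat P | P in model C1 C2 s] |
              psihat in [set: {mfun n.-tuple (obs R d k) >-> k.+1.-tuple R}]].

End model.
Arguments minimax_risk {R} d k C1 C2 s n.

(* Main.v *)
From HB Require Import structures.
Require Import Defs.
From mathcomp Require Import all_boot all_order all_algebra.
From mathcomp Require Import all_classical all_reals all_analysis.
From mathcomp Require Import measurable_realfun zify ring lra.

(** The bound is already forced by a finite family of laws in which the
    covariate is constant, the treatment is uniform on the K = k + 1 levels, and
    the outcome is Bernoulli with mean 1/2 + e on the treatments of a set S and
    mean 1/2 elsewhere.  A constant covariate is independent of everything, the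
    propensities are exactly 1/K, psi_a is 1/2 + e * [a in S], and such a law
    belongs to the model as soon as S has at most s elements ([hard_model]).
    These laws, and their n-fold products, live on finitely many points, so all
    risks are finite sums ([hard_risk]).

    Two sets S and a |: S, with a outside S, are hard to tell apart: the
    chi-square moment of one law of the sample against the other is
    (1 + 4 e^2 / K)^n ([sample_chi2]).  A second moment r is harmless if the
    errors under S are counted r times: an estimate of psi_a then has, in total
    over the two laws, weighted squared error at least e^2 / 2
    ([two_point_bound]).

    The pairs (S, a) with #|S| = s - 1 and a outside S correspond to the pairs
    (S', a) with #|S'| = s and a in S'.  For r = (K - s + 1) / s, the number of
    sets of size s divided by the number of sets of size s - 1, adding up the
    two-point bounds gives each of the two sizes the same total weight, and the
    bound s e^2 / (4 K) on the largest risk follows ([sparse_risk_bound]).  This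
    counting is what produces the logarithm: since r is of order K / s, it
    leaves room for n e^2 / K of order log (K / s), where a bare two-point
    argument would only allow n e^2 / K of order one.  The choice
    e^2 = min (K log (K / s) / n, 1) / 8 meets this budget ([chi2_budget]) and
    keeps e below 1/2. *)

Set Implicit Arguments.
Unset Strict Implicit.
Unset Printing Implicit Defensive.

Import Order.TTheory GRing.Theory Num.Theory.

Local Open Scope classical_set_scope.
Local Open Scope ring_scope.

(** * Probabilities carried by finitely many points *)

Section atoms.
Context {dT : measure_display} {T : measurableType dT} {R : realType}.

(** The law of e w, where w has weights p; e need not be injective.  Nonnegative
    integrands suffice to determine P and behave well under products. *)
Definition has_atoms (P : probability T R) (W : finType) (p : W -> R)
    (e : W -> T) : Prop :=
  forall f : T -> R, measurable_fun [set: T] f -> (forall z, 0 <= f z) ->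
    (\int[P]_z (f z)%:E = (\sum_w p w * f (e w))%:E)%E.

Lemma atomic_probability (W : finType) (p : W -> R) (e : W -> T) :
  (forall w, 0 <= p w) -> \sum_w p w = 1 ->
  exists P : probability T R, has_atoms P p e.
Proof.
move=> p0 p1.
have [w0 _] : exists w : W, true.
  apply/existsP; apply: contra_eqT p1 => /existsPn noW.
  by rewrite big1 ?[0 == 1]eq_sym ?oner_neq0// => w; have := noW w.
(* Sums of measures are indexed by nat: the default w0 is never reached. *)
pose w_ i := nth w0 (enum W) i.
pose m : nat -> {measure set T -> \bar R} :=
  fun i => mscale (NngNum (p0 (w_ i))) (dirac (e (w_ i))).
pose mu := msum m #|W|.
have intmu (f : T -> R) : measurable_fun [set: T] f -> (forall z, 0 <= f z) ->
    (\int[mu]_z (f z)%:E = (\sum_w p w * f (e w))%:E)%E.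
  move=> mf f0.
  rewrite ge0_integral_measure_sum//; last 2 first.
    by move=> z _; rewrite lee_fin.
    exact/measurable_EFinP.
  transitivity (\sum_(i < #|W|) (p (w_ i) * f (e (w_ i)))%:E)%E.
    apply: eq_bigr => i _; rewrite ge0_integral_mscale//; last 2 first.
    - exact/measurable_EFinP.
    - by move=> z _; rewrite lee_fin.
    rewrite integral_dirac//; last exact/measurable_EFinP.
    by rewrite diracT mul1e.
  by rewrite sumEFin -[in RHS]big_enum (big_nth w0)/= big_mkord -cardE.
have muT : mu [set: T] = 1%E.
  rewrite -[mu setT]mul1e -[LHS]integral_cst// (intmu (cst 1))//.
  by under eq_bigr do rewrite mulr1; rewrite p1.
(* Normalization leaves mu unchanged and is a probability by construction. *)
exists (mnormalize mu (dirac (e w0))).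
move=> f mf f0; rewrite -intmu//; congr (integral _ _ _); apply/funext => A.
by rewrite /= /mnormalize /= -/(mu _) -/(mu _) muT onee_eq0/= invr1 mule1.
Qed.

Section theory.
Variables (P : probability T R) (W : finType) (p : W -> R) (e : W -> T).
Hypothesis Pp : has_atoms P p e.

Lemma atoms_probE (A : set T) : measurable A ->
  P A = (\sum_w p w * \1_A (e w))%:E.
Proof.
move=> mA; rewrite -(Pp (f := \1_A))//.
by rewrite integral_indic// setIT.
Qed.

Lemma atoms_ae (A : set T) : measurable A -> (forall w, A (e w)) ->
  {ae P, forall z, A z}.
Proof.
move=> mA Ae; exists (~` A); split => //; first exact: measurableC.
rewrite atoms_probE; last exact: measurableC.
rewrite big1// => w _.
by rewrite indicE memNset ?mulr0//; apply.
Qed.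

Lemma atoms_integralE (f : T -> R) : measurable_fun [set: T] f ->
  (\int[P]_z (f z)%:E = (\sum_w p w * f (e w))%:E)%E.
Proof.
move=> mf; rewrite integralE.
under eq_integral do rewrite funeposE /= -EFin_max.
rewrite (Pp (f := fun z => Num.max (f z) 0)); last 2 first.
- by apply: measurable_maxr.
- by move=> z; rewrite le_max lexx orbT.
under eq_integral do rewrite funenegE /= -EFin_max.
rewrite (Pp (f := fun z => Num.max (- f z) 0)); last 2 first.
- by apply: measurable_maxr => //; apply: measurableT_comp.
- by move=> z; rewrite le_max lexx orbT.
rewrite -EFinB -sumrB; congr (_%:E); apply: eq_bigr => w _.
rewrite -mulrBr; congr (_ * _).
case: (leP 0 (f (e w))) => h.
  by rewrite max_r ?oppr_le0// subr0.
by rewrite max_l ?oppr_ge0 ?(ltW h)// sub0r opprK.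
Qed.

Lemma atoms_integral_setE (B : set T) (f : T -> R) :
  measurable B -> measurable_fun [set: T] f ->
  (\int[P]_(z in B) (f z)%:E = (\sum_w p w * (\1_B (e w) * f (e w)))%:E)%E.
Proof.
move=> mB mf; rewrite integral_mkcond.
rewrite -(atoms_integralE (f := fun z => \1_B z * f z)); last first.
  by apply: measurable_funM => //; exact: measurable_indic.
apply: eq_integral => z _; rewrite patchE indicE.
by case: ifP => _; rewrite ?mul1r ?mul0r.
Qed.

Lemma atoms_integrable (f : T -> R) : measurable_fun [set: T] f ->
  P.-integrable [set: T] (EFin \o f).
Proof.
move=> mf; apply/integrableP; split; first exact/measurable_EFinP.
rewrite (Pp (f := fun z => `|f z|)) ?ltry//.
exact: measurableT_comp.
Qed.

End theory.
End atoms.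

Lemma big_tuple_cons (R : nmodType) (W : finType) (n : nat)
    (F : n.+1.-tuple W -> R) :
  \sum_u F u = \sum_w \sum_(v : n.-tuple W) F [tuple of w :: v].
Proof.
rewrite pair_big/=.
rewrite (reindex (fun wv : W * n.-tuple W => [tuple of wv.1 :: wv.2]))//=.
exists (fun u => (thead u, [tuple of behead u])) => [[w v]|u] _ /=.
  by congr pair; apply: val_inj.
by rewrite [u in RHS]tuple_eta.
Qed.

(** Tonelli peels off one observation at a time, along the recursion that
    defines the product measure. *)
Lemma iid_has_atoms dT (T : measurableType dT) (R : realType)
    (P : probability T R) (W : finType) (p : W -> R) (e : W -> T) (n : nat) :
  (forall w, 0 <= p w) -> has_atoms P p e ->
  has_atoms (iid P n) (fun u : n.-tuple W => \prod_(i < n) p (tnth u i))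
    (map_tuple e).
Proof.
move=> p0 Pp; elim: n => [|n IHn] f mf f0 /=.
  rewrite integral_dirac//; last exact/measurable_EFinP.
  rewrite diracT mul1e (bigD1 [tuple])//= big_ord0 mul1r big1 ?addr0.
    by congr (f _)%:E; exact: val_inj.
  by move=> u /eqP[]; exact: tuple0.
have mcons : measurable_fun [set: T * n.-tuple T]
    (fun z => f (Defs.cons_tuple z)).
  by apply: (measurableT_comp mf); exact: Defs.measurable_cons_tuple.
rewrite ge0_integral_distribution//; first last.
  exact/measurable_EFinP.
rewrite fubini_tonelli1//=; first last.
- by move=> z; rewrite lee_fin.
- exact/measurable_EFinP.
rewrite /fubini_F /=.
under eq_integral => z _.
  rewrite (IHn (fun y => f (Defs.cons_tuple (z, y))))//; last first.
    by apply: (measurableT_comp mcons); exact: pair1_measurable.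
  over.
rewrite (Pp (fun z => \sum_(u : n.-tuple W) (\prod_(i < n) p (tnth u i)) *
  f (Defs.cons_tuple (z, map_tuple e u)))); last 2 first.
- apply: measurable_sum => u; apply: measurable_funM => //.
  by apply: (measurableT_comp mcons); exact: pair2_measurable.
- by move=> z; apply: sumr_ge0 => u _; rewrite mulr_ge0// prodr_ge0.
rewrite big_tuple_cons; congr _%:E; apply: eq_bigr => w _.
rewrite mulr_sumr; apply: eq_bigr => u _.
rewrite big_ord_recl tnth0 mulrA; congr (_ * _ * f _).
  by apply: eq_bigr => i _; rewrite tnthS.
exact: val_inj.
Qed.

(** * Two-point and sparse risk bounds *)

Section two_points.
Variables (R : realFieldType).

(** Already at each u the errors are at least
    e ^+ 2 * p u * (3 / 4 - p u / (4 * r * q u)), the difference being a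
    nonnegative combination of two squares.  After summation only the second
    moment of p / q remains, and it takes away at most e ^+ 2 / 4. *)
Lemma two_point_bound (U : finType) (q p : U -> R) (r e : R) (t : U -> R) :
  0 < r -> (forall u, 0 < q u) -> (forall u, 0 <= p u) ->
  \sum_u p u = 1 -> \sum_u p u ^+ 2 / q u <= r ->
  e ^+ 2 / 2 <= r * (\sum_u q u * t u ^+ 2) + \sum_u p u * (t u - e) ^+ 2.
Proof.
move=> r0 q0 p0 p1 chi.
have pw u : e ^+ 2 * (3 / 4 * p u - (4 * r)^-1 * (p u ^+ 2 / q u)) <=
    r * (q u * t u ^+ 2) + p u * (t u - e) ^+ 2.
  rewrite -subr_ge0.
  rewrite (_ : _ - _ = q u * r * (t u - e * (p u / q u) / (2 * r)) ^+ 2 +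
    p u * (t u - e / 2) ^+ 2); last first.
    by field; rewrite !gt_eqF.
  apply: addr_ge0; apply: mulr_ge0; rewrite ?sqr_ge0//.
  by rewrite mulr_ge0// ltW.
rewrite mulr_sumr -big_split/=; apply: le_trans (ler_sum _ (fun u _ => pw u)).
rewrite -mulr_sumr sumrB -!mulr_sumr p1 ler_wpM2l ?sqr_ge0//.
suff : (4 * r)^-1 * (\sum_u p u ^+ 2 / q u) <= 1 / 4 by lra.
by rewrite mulrC ler_pdivrMr ?mulr_gt0//; lra.
Qed.

End two_points.

Section supports.
Variable T : finType.

(** Double counting: adding a to S is a bijection between the two index sets. *)
Lemma sum_pointed_sets (V : nmodType) (s : nat) (F : {set T} -> T -> V) :
  \sum_(S : {set T} | #|S| == s) \sum_(a | a \notin S) F S a =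
  \sum_(S : {set T} | #|S| == s.+1) \sum_(a in S) F (S :\ a)%SET a.
Proof.
rewrite pair_big_dep [RHS]pair_big_dep/=.
rewrite (reindex_onto (fun Sa : {set T} * T => ((Sa.1 :\ Sa.2)%SET, Sa.2))
  (fun Sa => ((Sa.2 |: Sa.1)%SET, Sa.2)))/=; last first.
  by move=> [S a] /= /andP[_ aS]; rewrite finset.setU1K.
apply: eq_bigl => -[S a] /=; rewrite !inE eqxx/= andbT xpair_eqE eqxx andbT.
have [aS|aS] := boolP (a \in S).
  by rewrite finset.setD1K// eqxx (cardsD1 a S) aS add1n eqSS andbT.
rewrite andbF; apply/negbTE; rewrite negb_and orbC; apply/orP; left.
by apply: contraNneq aS => <-; rewrite finset.setU11.
Qed.

(** Q S a is the error at a under the law of S.  The weight of Q S a in the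
    two-point hypothesis is the ratio of the numbers of sets of sizes s.+1 and
    s, so that after summation over all pairs the smaller sets and the larger
    ones each contribute at most M times the number of larger sets. *)
Lemma sparse_risk_bound (R : realFieldType) (s : nat)
    (Q : {set T} -> T -> R) (c M : R) :
  (s < #|T|)%N -> (forall S a, 0 <= Q S a) ->
  (forall (S : {set T}) a, #|S| = s -> a \notin S ->
     c <= (#|T| - s)%:R / s.+1%:R * Q S a + Q (a |: S)%SET a) ->
  (forall S : {set T}, (#|S| <= s.+1)%N -> \sum_a Q S a <= M) ->
  s.+1%:R * c <= 2 * M.
Proof.
move=> sT Q0 Qc QM.
set r := _ / _ in Qc.
pose N m : R := \sum_(S : {set T} | #|S| == m) 1.
have NE m : N m = 'C(#|T|, m)%:R.
  rewrite /N sumr_const -card_draws; congr (_ *+ _).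
  by apply: eq_card => S; rewrite inE.
have N0 : 0 < N s.+1 by rewrite NE ltr0n bin_gt0.
have rN : r * N s = N s.+1.
  by rewrite !NE /r mulrAC -natrM -mul_bin_left natrM mulrAC divff ?mul1r//.
have lower : N s.+1 * (s.+1%:R * c) <=
    \sum_(S : {set T} | #|S| == s.+1)
      \sum_(a in S) (r * Q (S :\ a)%SET a + Q S a).
  rewrite mulr_suml ler_sum// => S /eqP cS.
  rewrite mul1r -cS mulr_natl -sumr_const; apply: ler_sum => a aS.
  rewrite -{2}(finset.setD1K aS); apply: Qc; last by rewrite !inE eqxx.
  by move: cS; rewrite (cardsD1 a S) aS add1n => -[].
have upper m (B : {set T} -> pred T) : (m <= s.+1)%N ->
    \sum_(S : {set T} | #|S| == m) \sum_(a | B S a) Q S a <= N m * M.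
  move=> ms; rewrite mulr_suml; apply: ler_sum => S /eqP cS.
  rewrite mul1r; apply: le_trans (QM S _); last by rewrite cS.
  by rewrite [leRHS](bigID (B S))/= lerDl sumr_ge0.
rewrite -(ler_pM2l N0); apply: le_trans lower _.
under eq_bigr do rewrite big_split -mulr_sumr/=.
rewrite big_split -mulr_sumr/=.
rewrite -(sum_pointed_sets s Q).
have r0 : 0 <= r by rewrite divr_ge0.
apply: le_trans (lerD (ler_wpM2l r0 (upper s _ (leqnSn s)))
  (upper s.+1 (fun S a => a \in S) (leqnn _))) _.
by rewrite mulrA rN mulrCA mulr_natl mulr2n.
Qed.

End supports.

(** * The sampling model with uniform arms *)

Section samples.
Variables (R : realFieldType) (W : finType).

Lemma sum_tuple_prod (n : nat) (g : W -> R) :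
  \sum_(u : n.-tuple W) \prod_(i < n) g (tnth u i) = (\sum_w g w) ^+ n.
Proof.
elim: n => [|n IHn].
  rewrite expr0 (bigD1 [tuple])//= big_ord0 big1 ?addr0//.
  by move=> u /eqP[]; exact: tuple0.
rewrite big_tuple_cons exprS -IHn mulr_suml; apply: eq_bigr => w _.
rewrite mulr_sumr; apply: eq_bigr => u _.
rewrite big_ord_recl tnth0; congr (_ * _).
by apply: eq_bigr => i _; rewrite tnthS.
Qed.

End samples.

Section arms.
Variables (R : realFieldType) (k : nat) (e : R).
Implicit Type S : {set 'I_k.+1}.

Definition arm_mean S (a : 'I_k.+1) : R := 2^-1 + e * (a \in S)%:R.

Definition arm_weight S (w : 'I_k.+1 * bool) : R :=
  k.+1%:R^-1 * (if w.2 then arm_mean S w.1 else 1 - arm_mean S w.1).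

Lemma sum_arms (F : 'I_k.+1 * bool -> R) :
  \sum_w F w = \sum_a (F (a, true) + F (a, false)).
Proof.
transitivity (\sum_a \sum_b F (a, b)).
  by rewrite pair_big; apply: eq_bigr => -[].
by apply: eq_bigr => a _; rewrite big_bool.
Qed.

Lemma sum_arm_weight S : \sum_w arm_weight S w = 1.
Proof.
rewrite sum_arms /arm_weight/=.
under eq_bigr do rewrite -mulrDr addrC subrK mulr1.
by rewrite sumr_const card_ord -[LHS]mulr_natl divff// pnatr_eq0.
Qed.

Hypotheses (e0 : 0 < e) (e1 : e < 2^-1).

Lemma arm_weight_gt0 S w : 0 < arm_weight S w.
Proof.
rewrite /arm_weight /arm_mean mulr_gt0 ?invr_gt0 ?ltr0n//.
move: e0 e1 => ? ?.
by case: w.2; case: (w.1 \in S); rewrite ?mulr1 ?mulr0; lra.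
Qed.

(** The two laws differ only at a, where the outcome is uniform under S. *)
Lemma arm_chi2 S a : a \notin S ->
  \sum_w arm_weight (a |: S)%SET w ^+ 2 / arm_weight S w =
  1 + 4 * e ^+ 2 / k.+1%:R.
Proof.
move=> aS; have k0 : (k.+1%:R : R) != 0 by rewrite pnatr_eq0.
have neq S' w : arm_weight S' w != 0 by rewrite gt_eqF// arm_weight_gt0.
have wE S' w : arm_weight S' w ^+ 2 / arm_weight S' w = arm_weight S' w.
  by rewrite expr2 mulfK.
rewrite sum_arms (bigD1 a)//=.
rewrite (eq_bigr (fun b => arm_weight S (b, true) + arm_weight S (b, false)));
  last first.
  move=> b ba.
  have off y : arm_weight (a |: S)%SET (b, y) = arm_weight S (b, y).
    by rewrite /arm_weight /arm_mean !inE (negbTE ba).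
  by rewrite !off !wE.
have := sum_arm_weight S; rewrite sum_arms (bigD1 a)//=.
move=> /(canRL (addKr _)) ->.
rewrite /arm_weight /arm_mean/= !inE eqxx (negbTE aS)/=.
move: k0; move: (k.+1%:R : R) => K K0.
by field.
Qed.

Definition sample_weight n S (u : n.-tuple ('I_k.+1 * bool)) : R :=
  \prod_(i < n) arm_weight S (tnth u i).

Lemma sample_weight_gt0 n S (u : n.-tuple _) : 0 < sample_weight S u.
Proof. by rewrite prodr_gt0// => i _; exact: arm_weight_gt0. Qed.

Lemma sum_sample_weight n S : \sum_(u : n.-tuple _) sample_weight S u = 1.
Proof. by rewrite sum_tuple_prod sum_arm_weight expr1n. Qed.

Lemma sample_chi2 n S a : a \notin S ->
  \sum_(u : n.-tuple _) sample_weight (a |: S)%SET u ^+ 2 / sample_weight S u =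
  (1 + 4 * e ^+ 2 / k.+1%:R) ^+ n.
Proof.
move=> aS; rewrite -(arm_chi2 aS) -sum_tuple_prod; apply: eq_bigr => u _.
by rewrite /sample_weight -prodrXl -prodf_div.
Qed.

(** The chi-square moment must not exceed the weight that the counting argument
    puts on the smaller of two neighbouring sets. *)
Lemma arms_risk_bound n s (est : n.-tuple ('I_k.+1 * bool) -> 'I_k.+1 -> R)
    (M : R) :
  (s < k.+1)%N ->
  (1 + 4 * e ^+ 2 / k.+1%:R) ^+ n <= (k.+1 - s)%:R / s.+1%:R ->
  (forall S, (#|S| <= s.+1)%N ->
    \sum_u sample_weight S u * \sum_a (est u a - arm_mean S a) ^+ 2 <= M) ->
  s.+1%:R * (e ^+ 2 / 4) <= M.
Proof.
move=> sk chi riskM.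
pose Q S a := \sum_u sample_weight S u * (est u a - arm_mean S a) ^+ 2.
suff : s.+1%:R * (e ^+ 2 / 2) <= 2 * M by lra.
apply: (@sparse_risk_bound _ _ s Q) => [||S a cS aS|S cS].
- by rewrite card_ord.
- move=> S a; apply: sumr_ge0 => u _.
  by rewrite mulr_ge0 ?sqr_ge0// ltW// sample_weight_gt0.
- rewrite card_ord /Q /arm_mean finset.setU11 (negbTE aS) mulr0 addr0 mulr1.
  rewrite [X in _ <= _ + X](eq_bigr (fun u => sample_weight (a |: S)%SET u *
    (est u a - 2^-1 - e) ^+ 2)) => [|u _]; last by rewrite opprD addrA.
  apply: two_point_bound => [|u|u||].
  + by rewrite divr_gt0 ?ltr0n// subn_gt0.
  + exact: sample_weight_gt0.
  + by rewrite ltW// sample_weight_gt0.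
  + exact: sum_sample_weight.
  + by rewrite sample_chi2.
- rewrite exchange_big/=; under eq_bigr do rewrite -mulr_sumr.
  exact: riskM.
Qed.

End arms.

(** * Conditional expectations under a finitely supported law *)

Section atomic_conditional_expectation.
Context {dT dU : measure_display} {T : measurableType dT}
  {TU : measurableType dU} {R : realType}.
Variables (P : probability T R) (W : finType) (p : W -> R) (e : W -> T).
Hypothesis Pp : has_atoms P p e.
Variables (V : T -> R) (U : T -> TU).
Hypotheses (mV : measurable_fun [set: T] V) (mU : measurable_fun [set: T] U).

Lemma atoms_is_cond_expectation (g : TU -> R) :
  measurable_fun [set: TU] g ->
  is_cond_expectation P V U g <->
  forall B, measurable B ->
    \sum_w p w * (\1_B (U (e w)) * g (U (e w))) =
    \sum_w p w * (\1_B (U (e w)) * V (e w)).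
Proof.
move=> mg; have mgU : measurable_fun [set: T] (g \o U).
  exact: measurableT_comp.
have mUB B : measurable B -> measurable (U @^-1` B).
  by move=> mB; rewrite -[X in measurable X]setTI; exact: mU.
have mean B (f : T -> R) : measurable B -> measurable_fun [set: T] f ->
    (\int[P]_(z in U @^-1` B) (f z)%:E =
     (\sum_w p w * (\1_B (U (e w)) * f (e w)))%:E)%E.
  by move=> mB mf; rewrite (atoms_integral_setE Pp (mUB _ mB) mf).
split=> [[_ _ gV] B mB|gV].
  have := gV B mB; rewrite (mean B _ mB mV).
  by rewrite (mean B (g \o U) mB mgU) => -[].
split=> [//||B mB]; first exact: (atoms_integrable Pp).
by rewrite (mean B (g \o U) mB mgU) (mean B V mB mV) gV.
Qed.

(** The version chosen by [cond_expectation] is only specified once some version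
    exists; exhibiting g makes the defining identities available for it. *)
Lemma atoms_cond_expectation (g : TU -> R) :
  measurable_fun [set: TU] g ->
  (forall B, measurable B ->
    \sum_w p w * (\1_B (U (e w)) * g (U (e w))) =
    \sum_w p w * (\1_B (U (e w)) * V (e w))) ->
  measurable_fun [set: TU] (cond_expectation P V U) /\
  forall B, measurable B ->
    \sum_w p w * (\1_B (U (e w)) * cond_expectation P V U (U (e w))) =
    \sum_w p w * (\1_B (U (e w)) * V (e w)).
Proof.
move=> mg gV; set h := cond_expectation P V U.
have hV : is_cond_expectation P V U h.
  apply: (xgetPex (cst 0) (P := [set g | is_cond_expectation P V U g])).
  by exists g; apply/(atoms_is_cond_expectation mg).
have mh : measurable_fun [set: TU] h by case: hV.
by split=> //; apply/(atoms_is_cond_expectation mh).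
Qed.

End atomic_conditional_expectation.

(** * The least favourable laws *)

Section hard_laws.
Variables (R : realType) (d k : nat) (e : R) (S : {set 'I_k.+1}).
Hypotheses (e0 : 0 < e) (e1 : e < 2^-1).

Definition no_covariate : d.-tuple R := [tuple of nseq d 0].

Definition hard_atom (w : 'I_k.+1 * bool) : obs R d k :=
  ((no_covariate, w.1), w.2%:R).

Variable P : probability (obs R d k) R.
Hypothesis Pp : has_atoms P (arm_weight e S) hard_atom.

Let p0 w : 0 <= arm_weight e S w.
Proof. exact/ltW/arm_weight_gt0. Qed.

Let mX : measurable_fun [set: obs R d k] covX.
Proof. exact: (measurableT_comp measurable_fst measurable_fst). Qed.

Let mA : measurable_fun [set: obs R d k] trtA.
Proof. exact: (measurableT_comp measurable_snd measurable_fst). Qed.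

Let mY : measurable_fun [set: obs R d k] outY.
Proof. exact: measurable_snd. Qed.

Let mtrt a : measurable [set z : obs R d k | trtA z = a].
Proof.
by rewrite -[X in measurable X]setTI; apply: (mA measurableT (Y := [set a])).
Qed.

Lemma sum_over_arm (F : 'I_k.+1 * bool -> R) a :
  \sum_w arm_weight e S w * ((w.1 == a)%:R * F w) =
  k.+1%:R^-1 * (arm_mean e S a * F (a, true) +
    (1 - arm_mean e S a) * F (a, false)).
Proof.
rewrite sum_arms (bigD1 a)//= eqxx big1 ?addr0 => [|b /negbTE ->]; last first.
  by rewrite !mul0r !mulr0 addr0.
by rewrite /arm_weight /= !mul1r -!mulrA -mulrDr.
Qed.

Lemma sum_over_arm1 a : \sum_w arm_weight e S w * (w.1 == a)%:R = k.+1%:R^-1.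
Proof.
have := sum_over_arm (fun=> 1) a.
by rewrite !mulr1 addrC subrK mulr1; under eq_bigr do rewrite mulr1.
Qed.

Let indic_trt a w : \1_[set z | trtA z = a] (hard_atom w) = (w.1 == a)%:R :> R.
Proof.
by rewrite indicE; congr (nat_of_bool _)%:R; apply/idP/eqP; rewrite in_setE.
Qed.

Let covXE w : covX (hard_atom w) = no_covariate.
Proof. by []. Qed.

Lemma hard_varpi a : varpi P a = k.+1%:R^-1.
Proof.
rewrite /varpi (atoms_probE Pp)//=.
by under eq_bigr do rewrite indic_trt; rewrite sum_over_arm1.
Qed.

(** The defining identity on the whole space pins the version at the only value
    of the covariate. *)
Lemma hard_propensity a : propensity P a no_covariate = k.+1%:R^-1.
Proof.
have mtrtE : measurable_fun [set: obs R d k]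
    (\1_[set z : obs R d k | trtA z = a] : _ -> R).
  exact: measurable_indic.
have [|B mB|_ /(_ setT measurableT)] :=
  atoms_cond_expectation Pp mtrtE mX (g := cst k.+1%:R^-1).
- exact: measurable_cst.
- under eq_bigr do rewrite /= covXE mulrCA.
  under [RHS]eq_bigr do rewrite /= covXE indic_trt mulrCA.
  by rewrite -!mulr_sumr -mulr_suml sum_arm_weight mul1r sum_over_arm1.
- under eq_bigr do rewrite indicT covXE mul1r.
  under [RHS]eq_bigr do rewrite indicT mul1r indic_trt.
  by rewrite -mulr_suml sum_arm_weight mul1r sum_over_arm1.
Qed.

(** The defining identity on the slice of treatment a pins the version at the
    only point of that slice which is charged. *)
Lemma hard_regression a :
  measurable_fun [set: d.-tuple R] (regression P a) /\
  regression P a no_covariate = arm_mean e S a.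
Proof.
have mXA : measurable_fun [set: obs R d k] (fun z => (covX z, trtA z)).
  exact/measurable_fun_pair.
have [|B mB|mg /(_ [set xa | xa.2 = a])] :=
  atoms_cond_expectation Pp mY mXA (g := fun xa => arm_mean e S xa.2).
- exact: (measurableT_comp (f := arm_mean e S) _ measurable_snd).
- rewrite !sum_arms; apply: eq_bigr => b _; rewrite /arm_weight/=.
  by rewrite mulr0 mulr0 addr0; ring.
- move=> gE; split.
    by apply: (measurableT_comp mg); exact: pair2_measurable.
  have indic w : \1_[set xa : d.-tuple R * 'I_k.+1 | xa.2 = a]
      (covX (hard_atom w), trtA (hard_atom w)) = (w.1 == a)%:R :> R.
    by rewrite indicE; congr (nat_of_bool _)%:R; apply/idP/eqP; rewrite in_setE.
  have mB : measurable [set xa : d.-tuple R * 'I_k.+1 | xa.2 = a].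
    rewrite -[X in measurable X]setTI.
    by apply: (measurable_snd measurableT [set a]).
  have := gE mB.
  under eq_bigr do rewrite indic.
  under [X in _ = X -> _]eq_bigr do rewrite indic.
  rewrite (sum_over_arm (fun w => regression P w.1 no_covariate)).
  rewrite (sum_over_arm (fun w => outY (hard_atom w)))/=.
  rewrite mulr0 addr0 mulr1 -mulrDl addrC subrK mul1r => /mulfI; apply.
  by rewrite invr_neq0// pnatr_eq0.
Qed.

Lemma hard_psi a : psi P a = arm_mean e S a.
Proof.
have [mreg regE] := hard_regression a.
rewrite /psi /Rintegral.
have mregX := measurableT_comp mreg mX.
rewrite (atoms_integralE Pp mregX).
under eq_bigr do rewrite /= covXE regE.
by rewrite -mulr_suml sum_arm_weight mul1r.
Qed.

Lemma hard_model C1 C2 s :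
  C1 <= 1 -> 1 <= C2 -> (#|S| <= s)%N -> model C1 C2 s P.
Proof.
move=> C11 C21 Ss; split.
- (* Propensities are known only at the constant covariate, which is hit almost
     surely. *)
  have mX0 : measurable [set z : obs R d k | covX z = no_covariate].
    have -> : [set z : obs R d k | covX z = no_covariate] =
        \bigcap_(i in [set: 'I_d])
          ((fun z => tnth (covX z) i) @^-1` [set 0]).
      apply/seteqP; split => z /= zE.
        by move=> i _; rewrite /= zE tnth_nseq.
      by apply: eq_from_tnth => i; rewrite (zE i I) tnth_nseq.
    apply: fin_bigcap_measurable; first exact: finite_finset.
    move=> i _; rewrite -[X in measurable X]setTI.
    apply: (measurableT_comp (measurable_tnth i) mX) => //.
  have := atoms_ae Pp mX0 covXE; apply: filterS => z zE a.
  rewrite zE hard_propensity -[X in _ <= X <= _]mul1r.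
  by rewrite !ler_pM2r ?invr_gt0 ?ltr0n// C11 C21.
- have m01 : measurable (@outY R d k @^-1` ([set 0] `|` [set 1])).
    by rewrite -[X in measurable X]setTI; apply: mY => //; exact: measurableU.
  by apply: (atoms_ae Pp m01) => -[a []]; [right|left].
- have mAY : measurable_fun [set: obs R d k] (fun z => (trtA z, outY z)).
    exact/measurable_fun_pair.
  move=> B D mB mD.
  have mAYB : measurable ((fun z : obs R d k => (trtA z, outY z)) @^-1` B).
    by rewrite -[X in measurable X]setTI; exact: mAY.
  have mXD : measurable (@covX R d k @^-1` D).
    by rewrite -[X in measurable X]setTI; exact: mX.
  rewrite !(atoms_probE Pp)//; last exact: measurableI.
  rewrite -EFinM; congr _%:E.
  have XD w : \1_(@covX R d k @^-1` D) (hard_atom w) = \1_D no_covariate :> R.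
    by [].
  under [X in _ = _ * X]eq_bigr do rewrite XD.
  rewrite -[X in _ = _ * X]mulr_suml sum_arm_weight mul1r mulr_suml.
  by apply: eq_bigr => w _; rewrite indicI /= XD mulrA.
- apply: leq_trans Ss; apply: subset_leq_card; apply/fintype.subsetP => a.
  rewrite inE hard_psi /arm_mean; apply: contraNT => /negbTE ->.
  by rewrite mulr0 addr0.
Qed.

Lemma hard_risk n (psihat : {mfun n.-tuple (obs R d k) >-> k.+1.-tuple R}) :
  risk psihat P = (k.+1%:R^-1 * \sum_u sample_weight e S u *
    \sum_a (tnth (psihat (map_tuple hard_atom u)) a - arm_mean e S a) ^+ 2)%:E.
Proof.
rewrite /risk (iid_has_atoms (n := n) p0 Pp (f := fun z =>
  \sum_a varpi P a * (tnth (psihat z) a - psi P a) ^+ 2)).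
- congr _%:E; rewrite mulr_sumr; apply: eq_bigr => u _.
  rewrite mulrCA [X in _ = _ * X]mulr_sumr; congr (_ * _).
  apply: eq_bigr => a _; by rewrite hard_varpi hard_psi.
- apply: measurable_sum => a; apply: measurable_funM => //.
  apply: measurable_funX; apply: measurable_funB => //.
  exact: (measurableT_comp (measurable_tnth a)).
- move=> z; apply: sumr_ge0 => a _.
  by rewrite hard_varpi mulr_ge0 ?sqr_ge0// invr_ge0.
Qed.

End hard_laws.

Lemma hard_law_exists (R : realType) (d k : nat) (e : R) (S : {set 'I_k.+1}) :
  0 < e -> e < 2^-1 ->
  exists P : probability (obs R d k) R,
    has_atoms P (arm_weight e S) (@hard_atom R d k).
Proof.
move=> e0 e1; apply: atomic_probability; last exact: sum_arm_weight.
by move=> w; rewrite ltW// arm_weight_gt0.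
Qed.

(** * The minimax bound *)

(** With x = K / s, the hypothesis gives (1 + 4 e^2 / K)^n <= sqrt x, while the
    right-hand side is at least x - 1; sqrt x <= x - 1 because 8 <= x.  The
    square root is avoided by squaring. *)
Lemma chi2_budget (R : realType) (K s n : nat) (e : R) :
  (0 < n)%N -> (0 < s)%N -> (8 * s <= K)%N ->
  e ^+ 2 <= K%:R * (ln (K%:R / s%:R) / n%:R) / 8 ->
  (1 + 4 * e ^+ 2 / K%:R) ^+ n <= (K - s.-1)%:R / s%:R.
Proof.
move=> n0 s0 sK he.
have s0' : 0 < s%:R :> R by rewrite ltr0n.
have n0' : 0 < n%:R :> R by rewrite ltr0n.
have K0' : 0 < K%:R :> R by rewrite ltr0n; lia.
set x : R := K%:R / s%:R in he *.
have x8 : 8 <= x by rewrite /x ler_pdivlMr// -natrM ler_nat.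
have xr : x - 1 <= (K - s.-1)%:R / s%:R.
  rewrite ler_pdivlMr// mulrBl /x mul1r divfK ?gt_eqF//.
  rewrite natrB; last by lia.
  by rewrite lerD2l lerN2 ler_nat leq_pred.
apply: le_trans xr; rewrite -ler_sqr ?nnegrE; last 2 first.
- by rewrite exprn_ge0// addr_ge0// divr_ge0// mulr_ge0// sqr_ge0.
- by lra.
apply: (@le_trans _ _ x); last by nra.
rewrite -exprM -[leRHS]lnK; last by rewrite posrE; lra.
have : 1 + 4 * e ^+ 2 / K%:R <= expR (ln x / (2 * n%:R)).
  apply: le_trans (expR_ge1Dx _).
  rewrite lerD2l ler_pdivrMr//.
  move: he; set l := ln x.
  rewrite (_ : K%:R * (l / n%:R) / 8 = l / (2 * n%:R) * K%:R / 4).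
    by lra.
  by field; rewrite gt_eqF.
move=> /(lerXn2r (n * 2)) /le_trans; apply.
- by rewrite nnegrE addr_ge0// divr_ge0// mulr_ge0// sqr_ge0.
- by rewrite nnegrE expR_ge0.
rewrite -expRM_natl ler_expR natrM.
rewrite [leLHS](_ : _ = ln x)//.
by field; rewrite gt_eqF.
Qed.

Theorem theorem2 (R : realType) (C1 C2 : R) :
  0 < C1 -> C1 <= 1 -> 1 <= C2 ->
  exists C : R, 0 < C /\
    forall d n s k : nat,
      (0 < n)%N -> (9 <= s)%N -> (8 * s <= k.+1)%N ->
      ((C * Num.min (s%:R * (ln (k.+1%:R / s%:R) / n%:R))
                    (s%:R / k.+1%:R))%:E
        <= minimax_risk d k C1 C2 s n)%E.
Proof.
(* 1 / 32 is the 1 / 4 of the sparse risk bound times the 1 / 8 in e2. *)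
move=> _ C11 C21; exists (1 / 32); split; first by lra.
move=> d n [//|s] k n0 _ sk.
set K : R := k.+1%:R; set L := ln (K / s.+1%:R) / n%:R.
have K0 : 0 < K by rewrite ltr0n.
have L0 : 0 < L.
  rewrite divr_gt0 ?ltr0n// ln_gt0// ltr_pdivlMr ?ltr0n// mul1r ltr_nat; lia.
pose e2 := Num.min (K * L) 1 / 8.
have e2_gt0 : 0 < e2 by rewrite divr_gt0// lt_min mulr_gt0//=.
have [e2KL e2_18] : e2 <= K * L / 8 /\ e2 <= 1 / 8.
  by rewrite /e2 !ler_pM2r ?invr_gt0// !ge_min !lexx orbT.
pose e := Num.sqrt e2.
have e0 : 0 < e by rewrite sqrtr_gt0.
have eE : e ^+ 2 = e2 by rewrite sqr_sqrtr// ltW.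
have e1 : e < 2^-1 by nra.
have targetE : 1 / 32 * Num.min (s.+1%:R * L) (s.+1%:R / K) =
    K^-1 * (s.+1%:R * (e ^+ 2 / 4)).
  rewrite eE /e2 (_ : s.+1%:R * L = s.+1%:R / K * (K * L)); last first.
    by field; rewrite gt_eqF.
  rewrite -[X in Num.min _ X]mulr1 -minr_pMr; last by rewrite divr_ge0// ltW.
  by field; rewrite gt_eqF.
apply: le_ereal_inf_tmp => _ [psihat _ <-].
rewrite targetE.
set M := ereal_sup _.
pose law (S : {set 'I_k.+1}) := sval (cid (hard_law_exists d S e0 e1)).
have lawP S : has_atoms (law S) (arm_weight e S) (@hard_atom R d k).
  exact: (svalP (cid (hard_law_exists d S e0 e1))).
have riskM (S : {set 'I_k.+1}) :
    (#|S| <= s.+1)%N -> (risk psihat (law S) <= M)%E.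
  move=> cS; apply: ereal_sup_ubound; exists (law S) => //.
  exact: (hard_model (lawP S) C11 C21 cS).
(* The supremum M may be infinite; the risk of the law of the empty set excludes
   the value -oo. *)
have := riskM finset.set0; rewrite cards0 => /(_ isT).
case: M riskM => [M riskM _|_ _|_]; first last.
- by rewrite (hard_risk e0 e1 (lawP _)).
- by rewrite leey.
rewrite lee_fin ler_pdivrMl//.
apply: (arms_risk_bound e0 e1 (est := fun u =>
  tnth (psihat (map_tuple (@hard_atom R d k) u)))).
- lia.
- apply: (chi2_budget (s := s.+1)) => //; by rewrite eE.
- move=> S cS; have := riskM S cS.
  by rewrite (hard_risk e0 e1 (lawP _)) lee_fin ler_pdivrMl.
Qed.
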